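(* Consider the following setting. Let $\mathcal{X}\subseteq\mathbb{R}^D$, $\mathcal{Y}=\{1,\dots,C\}$, $\mathcal{O}$ an output space, $f:\mathcal{X}\to\mathcal{O}$ a fixed deployed model, $\ell:\mathcal{O}\times\mathcal{Y}\to[0,1]$ a loss, and $f_{\mathrm{p}}$ a fixed predictive model; the synthetic label of $x$ is $\tilde y=\arg\max_c f_{\mathrm{p}}(x)[c]$. Let $P_0$ (source) and $P_1,P_2,\dots$ (test) be distributions on $\mathcal{X}\times\mathcal{Y}$, with $R_t=\mathbb{E}_{(x,y)\sim P_t}[\ell(f(x),y)]$ for $t\ge0$ and running test risk $\bar R_t=\frac1t\sum_{t'=1}^tR_{t'}$. At each time $t\ge1$, a labeled batch $\{(x_{t,i},y_{t,i})\}_{i=1}^{n_t}$ ($n_t\ge1$) i.i.d. from $P_t$ and an unlabeled batch $\{\tilde x_{t,j}\}_{j=n_t+1}^{n_t+N_t}$ ($N_t\ge1$) i.i.d. from the $\mathcal{X}$-marginal of $P_t$ are observed; source data (labeled and unlabeled) are drawn from $P_0$; all samples are mutually independent. Fix $\eta_{\max}>0$ and let $\{\eta_t\}_{t\ge1}$ with $\eta_t\in[0,\eta_{\max}]$ be any predictable sequence (each $\eta_t$ a function only of the data and synthetic labels observed at times $1,\dots,t-1$). Define the per-step estimate $$\hat R^{\mathrm{PP}}_t=\frac{\eta_t}{N_t}\sum_{j=n_t+1}^{n_t+N_t}\ell(f(\tilde x_{t,j}),\tilde y_{t,j})+\frac1{n_t}\sum_{i=1}^{n_t}\ell(f(x_{t,i}),y_{t,i})-\frac{\eta_t}{n_t}\sum_{i=1}^{n_t}\ell(f(x_{t,i}),\tilde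 y_{t,i}),$$ and $\hat{\bar R}^{\mathrm{PP}}_t=\frac1t\sum_{t'=1}^t\hat R^{\mathrm{PP}}_{t'}$. Let $Z_t=(\hat R^{\mathrm{PP}}_t+\eta_{\max})/(1+2\eta_{\max})\in[0,1]$, $\bar Z_t=\frac1t\sum_{t'=1}^tZ_{t'}$, $\bar Z_0$ a fixed constant in $[0,1]$, and $V_t^{\mathrm{PP}}=\sum_{t'=1}^t(Z_{t'}-\bar Z_{t'-1})^2$. Fix $\delta_{\mathrm S},\delta_{\mathrm T}\in(0,1)$ with $\delta_{\mathrm S}+\delta_{\mathrm T}\in(0,1)$, a probability distribution $q$ on $[0,1)$, let $\psi_E(\lambda)=-\log(1-\lambda)-\lambda$, and $u(V)=\sup\{S:\int_0^1q(\lambda)\exp(\lambda S-\psi_E(\lambda)V)\,d\lambda<1/\delta_{\mathrm T}\}$. Define the lower bound $L^{\mathrm{PP}}_t=\hat{\bar R}^{\mathrm{PP}}_t-(1+2\eta_{\max})\,u(V^{\mathrm{PP}}_t)/t$. Let $U_0^{\mathrm{PP}}$ be an upper bound on the source risk computed from the source data only and satisfying $\mathbb{P}(R_0\le U_0^{\mathrm{PP}})\ge1-\delta_{\mathrm S}$. For a tolerance $\epsilon_{\mathrm{tol}}>0$, define the alarm $\Phi^{\mathrm{PP}}_t=\mathbb{1}[L^{\mathrm{PP}}_t>U_0^{\mathrm{PP}}+\epsilon_{\mathrm{tol}}]$. Then for every sequence $P_1,P_2,\dots$ satisfying the null hypothesis $\mathcal{H}_0$: $\bar R_t\le R_0+\epsilon_{\mathrm{tol}}$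 for all $t\ge1$, $$\mathbb{P}\big(\exists\,t\ge1:\ \Phi^{\mathrm{PP}}_t=1\big)\le\delta_{\mathrm S}+\delta_{\mathrm T}.$$
   Context: This is the probability-of-false-alarm guarantee for prediction-powered risk monitoring (PPRM). In the paper, $U_0^{\mathrm{PP}}=\hat R_0^{\mathrm{PP}}+w_0^{\mathrm{PP}}$ where $\hat R_0^{\mathrm{PP}}$ is the analogous prediction-powered estimate on source data and $w_0^{\mathrm{PP}}$ is obtained from a betting-based confidence bound ensuring $\mathbb{P}(R_0\le U_0^{\mathrm{PP}})\ge1-\delta_{\mathrm S}$. *)

(* Defs.v *)
From HB Require Import structures.
From mathcomp Require Import all_boot all_order all_algebra.
From mathcomp Require Import all_classical all_reals all_analysis.
Set Implicit Arguments.
Unset Strict Implicit.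
Unset Printing Implicit Defensive.
Import Order.TTheory GRing.Theory Num.Theory.
Import numFieldNormedType.Exports.
Local Open Scope classical_set_scope.
Local Open Scope ring_scope.

(* The label space {1,...,C} is a finite type; we equip ordinals with the
   discrete sigma-algebra (every subset is measurable). *)
HB.instance Definition _ (n : nat) := isPointed.Build 'I_n.+1 ord0.
HB.instance Definition _ (n : nat) := @isMeasurable.Build default_measure_display
  'I_n.+1 discrete_measurable discrete_measurable0
  discrete_measurableC discrete_measurableU.

Definition mutually_independent {R : realType} {d : measure_display}
  {Omega : measurableType d} (P : probability Omega R)
  (I : Type) (Dom : set I) (F : I -> set (set Omega)) : Prop :=
  forall (k : nat) (g : 'I_k -> I), injective g -> (forall m, Dom (g m)) ->
  forall A : 'I_k -> set Omega, (forall m, F (g m) (A m)) ->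
  P (\big[setI/setT]_(m < k) A m) = (\prod_(m < k) P (A m))%E.

Definition preimg_sets {d d'} {Omega : measurableType d} {T : measurableType d'}
  (Xr : Omega -> T) : set (set Omega) :=
  [set Xr @^-1` B | B in measurable].

(** Indices of all samples:
    LabI t i   : i-th labeled test sample at time t   (valid for 1 <= t, i < n t)
    UnlI t j   : j-th unlabeled test sample at time t (valid for 1 <= t, j < N t)
    SrcLabI i  : i-th labeled source sample           (valid for i < n0)
    SrcUnlI j  : j-th unlabeled source sample         (valid for j < N0) *)
Inductive sample_idx :=
  | LabI of nat & nat | UnlI of nat & nat | SrcLabI of nat | SrcUnlI of nat.

Definition data_valid (n N : nat -> nat) (n0 N0 : nat) (i : sample_idx) : Prop :=
  match i with
  | LabI t k => (0 < t)%N /\ (k < n t)%N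
  | UnlI t k => (0 < t)%N /\ (k < N t)%N
  | SrcLabI k => (k < n0)%N
  | SrcUnlI k => (k < N0)%N
  end.

Definition observed_before (n N : nat -> nat) (t : nat) (i : sample_idx) : Prop :=
  match i with
  | LabI s k => (0 < s)%N /\ (s < t)%N /\ (k < n s)%N
  | UnlI s k => (0 < s)%N /\ (s < t)%N /\ (k < N s)%N
  | _ => False
  end.

Definition source_sample (n0 N0 : nat) (i : sample_idx) : Prop :=
  match i with
  | SrcLabI k => (k < n0)%N
  | SrcUnlI k => (k < N0)%N
  | _ => False
  end.

Definition data_sigma {d dX dY} {Omega : measurableType d}
  {X : measurableType dX} {Y : measurableType dY}
  (zl : nat -> nat -> Omega -> (X * Y)%type) (xu : nat -> nat -> Omega -> X)
  (zs : nat -> Omega -> (X * Y)%type) (xs : nat -> Omega -> X)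
  (i : sample_idx) : set (set Omega) :=
  match i with
  | LabI t k => preimg_sets (zl t k)
  | UnlI t k => preimg_sets (xu t k)
  | SrcLabI k => preimg_sets (zs k)
  | SrcUnlI k => preimg_sets (xs k)
  end.

Section pprm.
Context {R : realType}.

(** synthetic label: argmax_c f_p(x)[c] (ties broken by the library's arg max) *)
Definition synth_label {Xd : Type} {C : nat} (fp : Xd -> 'I_C.+1 -> R)
  (x : Xd) : 'I_C.+1 := [arg max_(c > ord0) fp x c]%O.

Definition risk {dX dY} {X : measurableType dX} {Y : measurableType dY}
  {O : Type} (Pd : probability (X * Y)%type R) (f : X -> O) (ell : O -> Y -> R) : R :=
  Rintegral Pd setT (fun z => ell (f z.1) z.2).

Definition Rhat_PP {Xd O : Type} {C : nat} (f : Xd -> O)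
  (ell : O -> 'I_C.+1 -> R) (fp : Xd -> 'I_C.+1 -> R) (n N : nat) (eta : R)
  (lab : nat -> (Xd * 'I_C.+1)%type) (unl : nat -> Xd) : R :=
  eta / N%:R * \sum_(j < N) ell (f (unl j)) (synth_label fp (unl j))
  + n%:R^-1 * \sum_(i < n) ell (f (lab i).1) (lab i).2
  - eta / n%:R * \sum_(i < n) ell (f (lab i).1) (synth_label fp (lab i).1).

Definition run_avg (a : nat -> R) (t : nat) : R :=
  t%:R^-1 * \sum_(1 <= s < t.+1) a s.

Definition Zseq (etamax : R) (Rh : nat -> R) (s : nat) : R :=
  (Rh s + etamax) / (1 + 2 * etamax).

Definition Zbar (z0 : R) (Z : nat -> R) (t : nat) : R :=
  if t is 0 then z0 else run_avg Z t.

Definition Vseq (z0 : R) (Z : nat -> R) (t : nat) : R :=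
  \sum_(1 <= s < t.+1) (Z s - Zbar z0 Z s.-1) ^+ 2.

Definition psiE (l : R) : R := - ln (1 - l) - l.

(** u(V) = sup { S : int_[0,1) exp(l S - psiE(l) V) dq(l) < 1/deltaT },
    taken in the extended reals (it may be +oo). *)
Definition u_bound (q : probability R R) (deltaT V : R) : \bar R :=
  ereal_sup [set S%:E | S in [set S : R |
    (\int[q]_(l in `[0%R, 1%R[) (expR (l * S - psiE l * V))%:E < (deltaT^-1)%:E)%E]].

Definition L_PP (etamax z0 : R) (q : probability R R) (deltaT : R)
  (Rh : nat -> R) (t : nat) : \bar R :=
  ((run_avg Rh t)%:E
   - ((1 + 2 * etamax) / t%:R)%:E * u_bound q deltaT (Vseq z0 (Zseq etamax Rh) t))%E.

End pprm.

(* Main.v *)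
(* Put Z_s = (Rhat_s + etamax) / (1 + 2 etamax), with values in [0,1].  Given the
   past, Z_s has mean mu_s = (R_s + etamax) / (1 + 2 etamax): labeled and unlabeled
   covariates have the same law, so the two synthetic-label terms cancel whatever
   the predictable weight eta_s.  By Fan's inequality
     exp (l x - psiE l x^2) <= 1 + l x   (0 <= l < 1, x >= -1)
   applied to x = Z_s - Zbar_{s-1}, the process
   exp (l sum_s (Z_s - mu_s) - psiE l V_t) is a nonnegative supermartingale for
   every l, hence so is its mixture over q (Tonelli).  Ville's inequality keeps the
   mixture below 1/deltaT for all t with probability at least 1 - deltaT, and on
   that event L_t <= Rbar_t for all t by the definition of u.  A false alarm then
   forces U0 < R_0, which has probability at most deltaS. *)
Require Import Defs.
From HB Require Import structures.
From mathcomp Require Import all_boot all_order all_algebra.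
From mathcomp Require Import all_classical all_reals all_analysis.
From mathcomp Require Import measurable_realfun ring lra.
Import Order.TTheory GRing.Theory Num.Theory.
Import numFieldNormedType.Exports.
Local Open Scope classical_set_scope.
Local Open Scope ring_scope.

(** * Fan's inequality *)

Lemma psiE_ge0 {R : realType} (l : R) : 0 <= l < 1 -> 0 <= psiE l.
Proof.
move=> /andP[l0 l1]; rewrite /psiE subr_ge0 -lerN2 opprK -[1 - l]/(1 + - l).
by apply: le_ln1Dx; rewrite ltrN2.
Qed.

(** Compare logarithms along [t] from 0 to [l]. The difference [h] vanishes at 0, and its derivative
    factors as [t * x ^+ 2 * ((1 - t)^-1 - (1 + t * x)^-1)]. This is nonnegative because [x >= -1]
    gives [1 - t <= 1 + t * x]. *)
Lemma fan_inequality {R : realType} (l x : R) : 0 <= l < 1 -> -1 <= x ->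
  expR (l * x - psiE l * x ^+ 2) <= 1 + l * x.
Proof.
move=> /andP[l0 l1] x1.
pose h (t : R) := ln (1 + t * x) - t * x + x ^+ 2 * psiE t.
have pos1 (t : R) : 0 <= t -> t < 1 -> 0 < 1 - t /\ 1 - t <= 1 + t * x.
  by move=> t0 t1; split; nra.
pose h' (t : R) := x / (1 + t * x) - x + x ^+ 2 * ((1 - t)^-1 - 1).
have dh (t : R) : 0 <= t -> t < 1 -> is_derive t 1 h (h' t).
  move=> t0 t1; have [p1 p2] := pos1 _ t0 t1.
  have p3 := lt_le_trans p1 p2.
  rewrite /h /h'.
  have L1 : is_derive t 1 (fun s : R => ln (1 + s * x)) (x / (1 + t * x)).
    have Dg : is_derive t 1 (fun s : R => 1 + s * x) x.
      by apply: is_derive_eq; rewrite /GRing.scale /=; ring.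
    have := @is_derive1_comp _ (@ln R) _ t _ _ (is_derive1_ln p3) Dg.
    by rewrite mulrC.
  have L2 : is_derive t 1 (fun s : R => ln (1 - s)) (- (1 - t)^-1).
    have Dg : is_derive t 1 (fun s : R => 1 - s) (- 1).
      by apply: is_derive_eq; rewrite /GRing.scale /=; ring.
    have := @is_derive1_comp _ (@ln R) _ t _ _ (is_derive1_ln p1) Dg.
    by rewrite mulrN1.
  rewrite /psiE; apply: is_derive_eq.
  rewrite /GRing.scale /=; ring.
have h'0 (t : R) : 0 <= t -> t < 1 -> 0 <= h' t.
  move=> t0 t1; have [p1 p2] := pos1 _ t0 t1.
  have p3 := lt_le_trans p1 p2.
  have -> : h' t = t * x ^+ 2 * ((1 - t)^-1 - (1 + t * x)^-1).
    by rewrite /h'; field; rewrite !gt_eqF.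
  apply: mulr_ge0; first by rewrite mulr_ge0 ?sqr_ge0.
  by rewrite subr_ge0 lef_pV2 ?posrE.
have : h 0 <= h l.
  apply: (@ger0_derive1_ndecr _ h 0 l) => //.
  - by move=> t; rewrite in_itv/= => /andP[t0 tl];
      have [] := dh t (ltW t0) (lt_trans tl l1).
  - move=> t; rewrite in_itv/= => /andP[t0 tl]; rewrite derive1E.
    have [_ ->] := dh t (ltW t0) (lt_trans tl l1).
    by rewrite h'0 ?(ltW t0)// (lt_trans tl l1).
  - apply: derivable_within_continuous => t; rewrite in_itv/= => /andP[t0 tl].
    by have [] := dh t t0 (le_lt_trans tl l1).
have [p1 p2] := pos1 _ l0 l1; have p3 := lt_le_trans p1 p2.
rewrite /h /psiE !mul0r !subr0 !addr0 ln1 !(oppr0, mulr0, addr0) => hl.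
rewrite -[leRHS](@lnK _) ?posrE// ler_expR.
rewrite /psiE; lra.
Qed.

(** * Independence *)

(** Classical equality and choice on indices allow finite families of samples to be handled as
    duplicate-free sequences. *)
HB.instance Definition _ := gen_eqMixin sample_idx.
HB.instance Definition _ := gen_choiceMixin sample_idx.

Section independence.
Context {R : realType} {d : measure_display} {Omega : measurableType d}
  (P : probability Omega R).

(** Sequences replace the injections from ordinals: they can be merged and extended by one index, as
    the pi-system argument below requires. *)
Lemma mutually_independent_seq (I : choiceType) (Dom : set I)
    (F : I -> set (set Omega)) (s : seq I) (A : I -> set Omega) :
  mutually_independent P Dom F -> uniq s ->
  (forall i, i \in s -> Dom i /\ F i (A i)) ->
  P (\big[setI/setT]_(i <- s) A i) = (\prod_(i <- s) P (A i))%E.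
Proof.
move=> ind us sA; rewrite big_tnth [RHS]big_tnth.
apply: (ind _ (tnth (in_tuple s)) _ _ (fun m => A (tnth (in_tuple s) m))).
- exact/tuple_uniqP.
- by move=> m; have [] := sA _ (mem_tnth m (in_tuple s)).
- by move=> m; have [] := sA _ (mem_tnth m (in_tuple s)).
Qed.

(* The finite intersections of members of the [F i] with [i] in [D] form a
   pi-system generating the left-hand sigma-algebra. *)
Lemma mutually_independent_sigma (I : choiceType) (Dom D : set I)
    (F : I -> set (set Omega)) (j : I) (A B : set Omega) :
  mutually_independent P Dom F ->
  (forall i, Dom i -> F i `<=` measurable) ->
  (forall i, Dom i -> F i setT /\ setI_closed (F i)) ->
  D `<=` Dom -> Dom j -> ~ D j ->
  <<s \bigcup_(i in D) F i >> A -> F j B -> P (A `&` B) = (P A * P B)%E.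
Proof.
move=> ind mF FI DDom Domj nDj sA FB.
pose Pi : set (set Omega) := [set X | exists s (C : I -> set Omega),
  [/\ uniq s, forall i, i \in s -> D i /\ F i (C i)
    & X = \big[setI/setT]_(i <- s) C i]].
have mB : measurable B by exact: (mF j).
have mPi : Pi `<=` measurable.
  move=> _ [s [C [_ sC ->]]]; rewrite big_seq.
  by apply: bigsetI_measurable => i /sC[/DDom Di]; exact: mF.
have PiI : setI_closed Pi.
  move=> _ _ [s1 [C1 [us1 sC1 ->]]] [s2 [C2 [us2 sC2 ->]]].
  (* An index missing from one of the two lists contributes [setT] there, so the merged family
     imposes exactly both sets of constraints. *)
  exists (undup (s1 ++ s2)), (fun i => (if i \in s1 then C1 i else setT) `&`
    (if i \in s2 then C2 i else setT)); split; first exact: undup_uniq.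
    move=> i; rewrite mem_undup mem_cat.
    case: (boolP (i \in s1)) => [/sC1[Di F1]|_];
      case: (boolP (i \in s2)) => [/sC2[Di' F2]|_] //= _; split => //.
    - by have [_] := FI i (DDom _ Di); exact.
    - by rewrite setIT.
    - by rewrite setTI.
  rewrite -!bigcap_seq; apply/seteqP; split => w /=.
    move=> [w1 w2] i /=; rewrite mem_undup mem_cat => is12.
    by split; case: ifPn => // ?; [exact: w1|exact: w2].
  move=> ws; split => i /= si.
    have /ws[+ _] : i \in undup (s1 ++ s2) by rewrite mem_undup mem_cat si.
    by rewrite si.
  have /ws[_] : i \in undup (s1 ++ s2) by rewrite mem_undup mem_cat si orbT.
  by rewrite si.
pose PB := NngNum (fine_ge0 (measure_ge0 P B)).
have PBE : (PB%:num)%:E = P B by rewrite /= fineK// fin_num_measure.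
(* With [B] fixed, both sides are finite measures in [A]: the restriction of [P] to [B], and [P]
   scaled by the number [P B]. They need only be compared on [Pi]. *)
suff : mrestr P mB A = mscale PB P A.
  by rewrite /mrestr /mscale PBE muleC.
apply: (@g_sigma_algebra_measure_unique _ _ _ Pi mPi (fun=> setT)) => //.
- by move=> _; exists [::], (fun=> setT); rewrite big_nil.
- by rewrite bigcup_const.
- move=> _ [s [C [us sC ->]]]; rewrite /= /mrestr /mscale PBE.
  (* Since [j] lies outside [D], the event [B] can be attached at index [j] without disturbing the
     other sets; independence is then applied to [j :: s]. *)
  pose C' (i : I) := if i == j then B else C i.
  have jns : j \notin s :> bool by apply/negP => /sC[].
  have eC : {in s, C' =1 C}.
    by move=> i si; rewrite /C'; case: eqP => // ij; rewrite -ij si in jns.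
  have -> : \big[setI/setT]_(i <- s) C i `&` B =
      \big[setI/setT]_(i <- j :: s) C' i.
    rewrite big_cons setIC /C' eqxx; congr setI.
    by apply: eq_big_seq => i /eC; rewrite /C' => ->.
  rewrite (mutually_independent_seq _ _ _ _ _ ind)/= ?jns//.
    rewrite big_cons {1}/C' eqxx; congr (_ * _)%E.
    rewrite (mutually_independent_seq _ _ _ _ _ ind) => //.
      by apply: eq_big_seq => i /eC ->.
    by move=> i /sC[/DDom].
  move=> i; rewrite inE => /predU1P[->|si]; first by rewrite /C' eqxx.
  by rewrite eC//; have [/DDom] := sC _ si.
- move=> _; rewrite /= /mrestr setTI; exact: le_lt_trans (probability_le1 P mB) (ltry _).
- apply: sub_sigma_algebra2 sA => X [i Di FX].
  by exists [:: i], (fun=> X); rewrite big_seq1; split => // k; rewrite inE => /eqP ->.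
Qed.

End independence.

Lemma measurable_g_sigma {d : measure_display} {Omega : measurableType d}
    (G : set (set Omega)) : G `<=` measurable ->
  <<s G >> `<=` measurable.
Proof. by move=> Gm; apply: smallest_sub => //; exact: sigma_algebra_measurable. Qed.

Lemma measurable_fun_g_sigma {d d' : measure_display} {Omega : measurableType d}
    {T : measurableType d'} (G : set (set Omega)) (f : Omega -> T) :
  G `<=` measurable ->
  measurable_fun setT (f : g_sigma_algebraType G -> T) -> measurable_fun setT f.
Proof.
move=> Gm mf _ B mB; apply: (measurable_g_sigma _ Gm).
exact: (mf measurableT B mB).
Qed.

(** * Expectation of a product of independent factors *)

Section independent_product.
Context {R : realType} {d d' : measure_display} {Omega : measurableType d}
  {T : measurableType d'} (P : probability Omega R).

(* Independence says that the law of [(w, Y w)], with [w] seen in the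
   coarser space, is a product measure; conclude with Tonelli. *)
Lemma integral_indepM (G : set (set Omega)) (Y : Omega -> T) (K : Omega -> R)
    (h : T -> R) :
  G `<=` measurable -> measurable_fun setT Y ->
  (forall A B, <<s G >> A -> measurable B ->
     P (A `&` Y @^-1` B) = (P A * P (Y @^-1` B))%E) ->
  measurable_fun setT (K : g_sigma_algebraType G -> R) -> measurable_fun setT h ->
  (forall w, 0 <= K w) -> (forall y, 0 <= h y) ->
  (\int[P]_w (K w * h (Y w))%:E =
   \int[P]_w (K w)%:E * \int[P]_w (h (Y w))%:E)%E.
Proof.
move=> Gm mY ind mK mh K0 h0.
pose OG : measurableType G.-sigma := g_sigma_algebraType G.
have mid : measurable_fun setT (id : Omega -> OG).
  by apply: measurable_fun_g_sigma Gm _; exact: measurable_id.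
have mXY : measurable_fun setT (fun w : Omega => (w : OG, Y w)).
  exact: measurable_fun_pair.
pose X : {mfun Omega >-> OG} := HB.pack (id : Omega -> OG)
  (isMeasurableFun.Build _ _ _ _ _ mid).
pose Ym : {mfun Omega >-> T} := HB.pack Y (isMeasurableFun.Build _ _ _ _ _ mY).
pose XY : {mfun Omega >-> (OG * T)%type} := HB.pack (fun w : Omega => (w : OG, Y w))
  (isMeasurableFun.Build _ _ _ _ _ mXY).
pose F (z : OG * T) := (K z.1 * h z.2)%:E.
have F0 z : (0 <= F z)%E by rewrite lee_fin mulr_ge0.
have mF : measurable_fun setT F.
  apply/measurable_EFinP; apply: measurable_funM.
    exact: measurableT_comp mK measurable_fst.
  exact: measurableT_comp mh measurable_snd.
have -> : (\int[P]_w (K w * h (Y w))%:E = \int[distribution P XY]_z F z)%E.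
  by rewrite ge0_integral_distribution.
have -> : (\int[distribution P XY]_z F z =
    \int[distribution P X \x distribution P Ym]_z F z)%E.
  apply: eq_measure_integral => A mA _; apply/esym.
  by apply: product_measure_unique => // B C mB mC; rewrite -ind.
rewrite fubini_tonelli1// /fubini_F /F/=.
have mK' : measurable_fun setT (fun x : OG => (K x)%:E) by exact/measurable_EFinP.
have mh' : measurable_fun setT (fun y : T => (h y)%:E) by exact/measurable_EFinP.
under eq_integral.
  move=> x _; under eq_integral do rewrite EFinM.
  rewrite ge0_integralZl ?lee_fin//; [|by move=> y _; rewrite lee_fin].
  rewrite muleC ge0_integral_distribution//.
  over.
rewrite ge0_integralZl//; first last.
- by apply: integral_ge0 => w _ /=; rewrite lee_fin.
- by move=> x _; rewrite lee_fin.
by rewrite muleC ge0_integral_distribution// => w; rewrite lee_fin.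
Qed.

End independent_product.

(** * Betting supermartingales *)

(** The sigma-algebra is the one carried by the domain type. Casting a function to
    [g_sigma_algebraType G -> R] therefore turns the same predicate into measurability with respect
    to the past. *)
Definition bounded_mfun {R : realType} {d : measure_display}
  {Omega : measurableType d} (f : Omega -> R) : Prop :=
  measurable_fun setT f /\ exists M, forall w, `|f w| <= M.

Section bounded_mfun_theory.
Context {R : realType} {d : measure_display} {Omega : measurableType d}.
Implicit Types f g : Omega -> R.

Lemma bounded_mfun_cst (c : R) : bounded_mfun (fun _ : Omega => c).
Proof. by split => //; exists `|c|. Qed.

Lemma bounded_mfunD f g : bounded_mfun f -> bounded_mfun g ->
  bounded_mfun (fun w => f w + g w).
Proof.
move=> [mf [M fM]] [mg [M' gM]]; split; first exact: measurable_funD.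
by exists (M + M') => w; apply: le_trans (ler_normD _ _) _; exact: lerD.
Qed.

Lemma bounded_mfunM f g : bounded_mfun f -> bounded_mfun g ->
  bounded_mfun (fun w => f w * g w).
Proof.
move=> [mf [M fM]] [mg [M' gM]]; split; first exact: measurable_funM.
by exists (M * M') => w; rewrite normrM; exact: ler_pM.
Qed.

Lemma bounded_mfunB f g : bounded_mfun f -> bounded_mfun g ->
  bounded_mfun (fun w => f w - g w).
Proof.
move=> [mf [M fM]] [mg [M' gM]]; split; first exact: measurable_funB.
by exists (M + M') => w; apply: le_trans (ler_normB _ _) _; exact: lerD.
Qed.

Lemma bounded_mfun_sum (n : nat) (F : 'I_n -> Omega -> R) :
  (forall i, bounded_mfun (F i)) -> bounded_mfun (fun w => \sum_(i < n) F i w).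
Proof.
elim: n F => [|n IH] F bF.
  rewrite (_ : (fun w => _) = (fun=> 0)); first exact: bounded_mfun_cst.
  by apply/funext => w; rewrite big_ord0.
rewrite (_ : (fun w => _) = (fun w => F ord0 w + \sum_(i < n) F (lift ord0 i) w)).
  by apply: bounded_mfunD => //; exact: IH.
by apply/funext => w; rewrite big_ord_recl.
Qed.

Lemma bounded_mfun_expR f : bounded_mfun f -> bounded_mfun (fun w => expR (f w)).
Proof.
move=> [mf [M fM]]; split; first exact: measurableT_comp (@measurable_expR R) mf.
exists (expR M) => w; rewrite ger0_norm ?expR_ge0// ler_expR.
exact: le_trans (ler_norm _) (fM w).
Qed.

Lemma bounded_mfun_indic (A : set Omega) : measurable A ->
  bounded_mfun (\1_A : Omega -> R).
Proof.
move=> mA; split; first exact: measurable_indic.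
by exists 1 => w; rewrite indicE; case: (_ \in _); rewrite ?normr1// normr0.
Qed.

Lemma bounded_mfun01 f : measurable_fun setT f -> (forall w, 0 <= f w <= 1) ->
  bounded_mfun f.
Proof.
move=> mf f01; split => //; exists 1 => w.
by have /andP[f0 f1] := f01 w; rewrite ger0_norm.
Qed.

Variable P : probability Omega R.

Lemma bounded_mfun_integrable f : bounded_mfun f ->
  P.-integrable setT (EFin \o f).
Proof.
move=> [mf [M fM]]; apply: measurable_bounded_integrable => //.
  exact: le_lt_trans (probability_le1 P measurableT) (ltry _).
by exists M; split; [exact: num_real|move=> N /ltW MN w _; exact: le_trans MN].
Qed.

Lemma Rintegral_bounded f : bounded_mfun f ->
  (\int[P]_w (f w)%:E)%E = (\int[P]_w f w)%:E.
Proof.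
move=> bf; rewrite fineK//; apply: integrable_fin_num => //.
exact: bounded_mfun_integrable.
Qed.

Lemma Rintegral_sum_bounded (n : nat) (F : 'I_n -> Omega -> R) :
  (forall i, bounded_mfun (F i)) ->
  \int[P]_w (\sum_(i < n) F i w) = \sum_(i < n) \int[P]_w F i w.
Proof.
elim: n F => [|n IH] F bF.
  rewrite big_ord0; under eq_Rintegral do rewrite big_ord0.
  by rewrite Rintegral_cst// mul0r.
rewrite big_ord_recl -IH//; under eq_Rintegral do rewrite big_ord_recl.
rewrite RintegralD//; apply: bounded_mfun_integrable => //.
exact: bounded_mfun_sum.
Qed.

End bounded_mfun_theory.

(* A supermartingale increment: Fan's inequality linearises the exponential
   around the past-measurable centre [c], and [(1 - a) e^a <= 1] absorbs the
   difference between [c] and the conditional mean [mu]. *)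
Lemma supermartingale_step {R : realType} {d : measure_display}
    {Omega : measurableType d} (P : probability Omega R)
    (G : set (set Omega)) (Z c K : Omega -> R) (mu l : R) :
  G `<=` measurable -> 0 <= l < 1 ->
  measurable_fun setT Z -> (forall w, 0 <= Z w <= 1) ->
  bounded_mfun (c : g_sigma_algebraType G -> R) -> (forall w, 0 <= c w <= 1) ->
  bounded_mfun (K : g_sigma_algebraType G -> R) -> (forall w, 0 <= K w) ->
  (forall H : Omega -> R, bounded_mfun (H : g_sigma_algebraType G -> R) ->
     (forall w, 0 <= H w) ->
     \int[P]_w (H w * Z w) = mu * \int[P]_w H w) ->
  (\int[P]_w (K w * expR (l * (Z w - mu) - psiE l * (Z w - c w) ^+ 2))%:E
     <= \int[P]_w (K w)%:E)%E.
Proof.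
move=> Gm l01 mZ Z01 bc c01 bK K0 HZ.
have up (f : Omega -> R) : bounded_mfun (f : g_sigma_algebraType G -> R) ->
    bounded_mfun f by case=> mf bf; split => //; exact: measurable_fun_g_sigma mf.
(* Writing [l * (Z - mu)] as [l * (c - mu) + l * (Z - c)] isolates a factor measurable for [G],
   which joins the weight [K]. *)
pose H w := K w * expR (l * (c w - mu)).
have bH : bounded_mfun (H : g_sigma_algebraType G -> R).
  apply: bounded_mfunM => //; apply: bounded_mfun_expR.
  apply: bounded_mfunM; first exact: bounded_mfun_cst.
  by apply: bounded_mfunB => //; exact: bounded_mfun_cst.
have H0 w : 0 <= H w by rewrite mulr_ge0 ?expR_ge0.
have bZ := bounded_mfun01 _ mZ Z01.
have bx : bounded_mfun
    (fun w => K w * expR (l * (Z w - mu) - psiE l * (Z w - c w) ^+ 2)).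
  apply: bounded_mfunM; first exact: up.
  apply/bounded_mfun_expR/bounded_mfunB.
    apply: bounded_mfunM; first exact: bounded_mfun_cst.
    by apply: bounded_mfunB => //; exact: bounded_mfun_cst.
  apply: bounded_mfunM; first exact: bounded_mfun_cst.
  by apply: bounded_mfunM; apply: bounded_mfunB => //; exact: up.
rewrite !Rintegral_bounded// ?lee_fin; last exact: up.
have bHc : bounded_mfun (fun w => H w * (1 - l * c w)).
  apply: bounded_mfunM; first exact: up.
  apply: bounded_mfunB; first exact: bounded_mfun_cst.
  by apply: bounded_mfunM; [exact: bounded_mfun_cst|exact: up].
have bHZ : bounded_mfun (fun w => H w * Z w) by apply: bounded_mfunM => //; exact: up.
have blHZ : bounded_mfun (fun w => l * (H w * Z w)).
  by apply: bounded_mfunM => //; exact: bounded_mfun_cst.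
have blH : bounded_mfun (fun w => l * mu * H w).
  by apply: bounded_mfunM; [exact: bounded_mfun_cst|exact: up].
apply: (@le_trans _ _ (\int[P]_w (H w * (1 - l * c w) + l * (H w * Z w)))).
  apply: le_Rintegral => //.
  - exact: bounded_mfun_integrable.
  - by apply: bounded_mfun_integrable; exact: bounded_mfunD.
  move=> w _; rewrite /H.
  have -> : l * (Z w - mu) - psiE l * (Z w - c w) ^+ 2 =
    l * (c w - mu) + (l * (Z w - c w) - psiE l * (Z w - c w) ^+ 2) by ring.
  have -> : K w * expR (l * (c w - mu)) * (1 - l * c w) +
    l * (K w * expR (l * (c w - mu)) * Z w) =
    K w * expR (l * (c w - mu)) * (1 + l * (Z w - c w)) by ring.
  rewrite expRD mulrA ler_wpM2l// ?mulr_ge0 ?expR_ge0//.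
  apply: fan_inequality => //.
  have /andP[Z0 Z1] := Z01 w; have /andP[c0 c1] := c01 w; lra.
rewrite RintegralD//; try exact: bounded_mfun_integrable.
rewrite RintegralZl//; last exact: bounded_mfun_integrable.
(* Fan's bound is affine in [Z], so centering under the weight [H] is enough to replace [Z] by its
   mean [mu]. *)
rewrite HZ// mulrA -RintegralZl//; last exact/bounded_mfun_integrable/up.
rewrite -RintegralD//; try exact: bounded_mfun_integrable.
apply: le_Rintegral => //.
- by apply: bounded_mfun_integrable; exact: bounded_mfunD.
- exact/bounded_mfun_integrable/up.
move=> w _; rewrite /H.
have -> : K w * expR (l * (c w - mu)) * (1 - l * c w) +
    l * mu * (K w * expR (l * (c w - mu))) =
  K w * (expR (l * (c w - mu)) * (1 + - (l * (c w - mu)))) by ring.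
rewrite ler_piMr// (le_trans (ler_wpM2l _ (expR_ge1Dx _))) ?expR_ge0//.
by rewrite -expRD subrr expR0.
Qed.

(** * Conditional mean of the prediction-powered estimate *)

Section centering.
Context {R : realType} {d dX : measure_display} {Omega : measurableType d}
  {X : measurableType dX} (P : probability Omega R) (G : set (set Omega)).
Hypothesis Gm : G `<=` measurable.

Lemma ge0_integral_law {d' : measure_display} {T : measurableType d'}
    (Q : probability T R) (Y : Omega -> T) (h : T -> R) :
  measurable_fun setT Y -> (forall B, measurable B -> P (Y @^-1` B) = Q B) ->
  measurable_fun setT h -> (forall y, 0 <= h y) ->
  (\int[P]_w (h (Y w))%:E = \int[Q]_y (h y)%:E)%E.
Proof.
move=> mY lawY mh h0.
rewrite -(@ge0_integral_pushforward _ _ _ _ _ Y mY P setT (EFin \o h))//.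
- by apply: eq_measure_integral => A mA _; exact: lawY.
- exact/measurable_EFinP.
- by move=> y _; rewrite lee_fin.
Qed.

Lemma Rintegral_indepM {d' : measure_display} {T : measurableType d'}
    (Y : Omega -> T) (K : Omega -> R) (h : T -> R) :
  measurable_fun setT Y ->
  (forall A B, <<s G >> A -> measurable B ->
     P (A `&` Y @^-1` B) = (P A * P (Y @^-1` B))%E) ->
  bounded_mfun (K : g_sigma_algebraType G -> R) -> (forall w, 0 <= K w) ->
  measurable_fun setT h -> (forall y, 0 <= h y <= 1) ->
  \int[P]_w (K w * h (Y w)) = \int[P]_w K w * \int[P]_w h (Y w).
Proof.
move=> mY ind [mK bK] K0 mh h01.
have bKP : bounded_mfun K by split => //; exact: measurable_fun_g_sigma mK.
have bhY : bounded_mfun (fun w => h (Y w)).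
  by apply: bounded_mfun01 => //; exact: measurableT_comp mh mY.
have := @integral_indepM _ _ _ _ _ P G Y K h Gm mY ind mK mh K0 _.
rewrite !Rintegral_bounded//; last exact: bounded_mfunM.
rewrite -EFinM => H; apply: EFin_inj; apply: H => y.
by have /andP[] := h01 y.
Qed.

Context {O : Type} {C : nat} (f : X -> O) (ell : O -> 'I_C.+1 -> R)
  (fp : X -> 'I_C.+1 -> R).
Hypothesis ell01 : forall o c, 0 <= ell o c <= 1.
Hypothesis mell : measurable_fun setT
  (fun z : (X * 'I_C.+1)%type => ell (f z.1) z.2).
Hypothesis mell_synth : measurable_fun setT
  (fun x : X => ell (f x) (synth_label fp x)).

(* The two synthetic-label averages have the same mean, so the weight [eta]
   cancels out. *)
Lemma Rhat_PP_centered (Pd : probability (X * 'I_C.+1)%type R) (n N : nat)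
    (zl : nat -> Omega -> (X * 'I_C.+1)%type) (xu : nat -> Omega -> X)
    (eta K : Omega -> R) (etamax : R) :
  (0 < n)%N -> (0 < N)%N ->
  (forall i, (i < n)%N -> measurable_fun setT (zl i)) ->
  (forall j, (j < N)%N -> measurable_fun setT (xu j)) ->
  (forall i, (i < n)%N -> forall B, measurable B -> P (zl i @^-1` B) = Pd B) ->
  (forall j, (j < N)%N -> forall B, measurable B ->
     P (xu j @^-1` B) = Pd (B `*` setT)) ->
  (forall i, (i < n)%N -> forall A B, <<s G >> A -> measurable B ->
     P (A `&` zl i @^-1` B) = (P A * P (zl i @^-1` B))%E) ->
  (forall j, (j < N)%N -> forall A B, <<s G >> A -> measurable B ->
     P (A `&` xu j @^-1` B) = (P A * P (xu j @^-1` B))%E) ->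
  measurable_fun setT (eta : g_sigma_algebraType G -> R) ->
  (forall w, 0 <= eta w <= etamax) ->
  bounded_mfun (K : g_sigma_algebraType G -> R) -> (forall w, 0 <= K w) ->
  \int[P]_w (K w * Rhat_PP f ell fp n N (eta w) (zl ^~ w) (xu ^~ w)) =
  risk Pd f ell * \int[P]_w K w.
Proof.
move=> n0 N0 mzl mxu lzl lxu izl ixu meta etar bK K0.
pose h x := ell (f x) (synth_label fp x).
pose g (z : X * 'I_C.+1) := ell (f z.1) z.2.
pose h1 (z : X * 'I_C.+1) := h z.1.
have h01 x : 0 <= h x <= 1 by exact: ell01.
have g01 z : 0 <= g z <= 1 by exact: ell01.
have mh1 : measurable_fun setT h1 by exact: measurableT_comp mell_synth measurable_fst.
have eta0 w : 0 <= eta w by have /andP[] := etar w.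
have beta : bounded_mfun (eta : g_sigma_algebraType G -> R).
  split => //; exists etamax => w; have /andP[e0 e1] := etar w.
  by rewrite ger0_norm.
(* The tuning weight depends on the past only, so it can be absorbed into the past-measurable
   factor. *)
pose Ke w := K w * eta w.
have bKe : bounded_mfun (Ke : g_sigma_algebraType G -> R) by exact: bounded_mfunM.
have Ke0 w : 0 <= Ke w by rewrite mulr_ge0.
have up (k : Omega -> R) : bounded_mfun (k : g_sigma_algebraType G -> R) ->
    bounded_mfun k by case=> mf bf; split => //; exact: measurable_fun_g_sigma mf.
pose b := \int[Pd]_z h1 z.
have Eg (i : 'I_n) : \int[P]_w g (zl i w) = risk Pd f ell.
  rewrite /risk /Rintegral (ge0_integral_law Pd (zl i) g)//; [exact: mzl|exact: lzl|].
  by move=> z; have /andP[] := g01 z.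
have Eh1 (i : 'I_n) : \int[P]_w h1 (zl i w) = b.
  rewrite /b /Rintegral (ge0_integral_law Pd (zl i) h1)//; [exact: mzl|exact: lzl|].
  by move=> z; have /andP[] := h01 z.1.
(* The law of an unlabeled covariate is the image of [Pd] under the first projection, which gives
   the same mean [b] as for labeled covariates. *)
have Eh (j : 'I_N) : \int[P]_w h (xu j w) = b.
  pose Xf : {mfun (X * 'I_C.+1)%type >-> X} :=
    HB.pack (fst : X * 'I_C.+1 -> X) (isMeasurableFun.Build _ _ _ _ _ measurable_fst).
  rewrite /b /Rintegral (ge0_integral_law (distribution Pd Xf) (xu j) h)//.
  - rewrite ge0_integral_distribution//; first exact/measurable_EFinP.
    by move=> x; rewrite lee_fin; have /andP[] := h01 x.
  - exact: mxu.
  - move=> B mB; rewrite lxu//; congr (Pd _).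
    by apply/seteqP; split => -[x y] //= [].
  - by move=> x; have /andP[] := h01 x.
have bh (j : 'I_N) : bounded_mfun (fun w => h (xu j w)).
  by apply: bounded_mfun01 => //; exact: measurableT_comp mell_synth (mxu _ _).
have bg (i : 'I_n) : bounded_mfun (fun w => g (zl i w)).
  by apply: bounded_mfun01 => //; exact: measurableT_comp mell (mzl _ _).
have bh1 (i : 'I_n) : bounded_mfun (fun w => h1 (zl i w)).
  apply: bounded_mfun01; first exact: measurableT_comp mh1 (mzl _ _).
  by move=> w; exact: h01.
have b1 (j : 'I_N) : bounded_mfun (fun w => N%:R^-1 * (Ke w * h (xu j w))).
  apply: bounded_mfunM; first exact: bounded_mfun_cst.
  by apply: bounded_mfunM => //; exact: up.
have b2 (i : 'I_n) : bounded_mfun (fun w => n%:R^-1 * (K w * g (zl i w))).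
  apply: bounded_mfunM; first exact: bounded_mfun_cst.
  by apply: bounded_mfunM => //; exact: up.
have b3 (i : 'I_n) : bounded_mfun (fun w => n%:R^-1 * (Ke w * h1 (zl i w))).
  apply: bounded_mfunM; first exact: bounded_mfun_cst.
  by apply: bounded_mfunM => //; exact: up.
(* Each summand becomes a past-measurable weight times a function of a single sample, so
   independence applies term by term. *)
transitivity (\int[P]_w (\sum_(j < N) N%:R^-1 * (Ke w * h (xu j w)) +
    \sum_(i < n) n%:R^-1 * (K w * g (zl i w)) -
    \sum_(i < n) n%:R^-1 * (Ke w * h1 (zl i w)))).
  apply: eq_Rintegral => w _; rewrite /Rhat_PP /Ke -!mulr_sumr; ring.
have B1 := bounded_mfun_sum _ _ b1.
have B2 := bounded_mfun_sum _ _ b2.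
have B3 := bounded_mfun_sum _ _ b3.
rewrite RintegralB//;
  [|exact/bounded_mfun_integrable/bounded_mfunD|exact/bounded_mfun_integrable].
rewrite RintegralD//; [|exact/bounded_mfun_integrable|exact/bounded_mfun_integrable].
rewrite !Rintegral_sum_bounded//.
under eq_bigr => j _.
  rewrite RintegralZl//; last first.
    by apply/bounded_mfun_integrable/bounded_mfunM => //; exact: up.
  rewrite (Rintegral_indepM (xu j) Ke h)//; [|exact: mxu|exact: ixu].
  rewrite Eh; over.
under [X in _ + X - _]eq_bigr => i _.
  rewrite RintegralZl//; last first.
    by apply/bounded_mfun_integrable/bounded_mfunM => //; exact: up.
  rewrite (Rintegral_indepM (zl i) K g)//; [|exact: mzl|exact: izl].
  rewrite Eg; over.
under [X in _ - X]eq_bigr => i _.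
  rewrite RintegralZl//; last first.
    by apply/bounded_mfun_integrable/bounded_mfunM => //; exact: up.
  rewrite (Rintegral_indepM (zl i) Ke h1)//;
    [|exact: mzl|exact: izl|by move=> z; exact: h01].
  rewrite Eh1; over.
have avg (m : nat) (x : R) : (0 < m)%N -> (m%:R^-1 * x) *+ m = x.
  by move=> m0; rewrite -mulr_natl mulrA divff ?mul1r// pnatr_eq0 -lt0n.
(* The first and third averages both equal [b] times the integral of [Ke], and cancel. *)
by rewrite !sumr_const !card_ord !avg// addrC addKr mulrC.
Qed.

End centering.

(** * Ville's maximal inequality *)

Section ville.
Context {R : realType} {d : measure_display} {Omega : measurableType d}
  (P : probability Omega R).
Local Open Scope ereal_scope.

(** Markov's inequality that keeps the integral over the part below the level; this remainder is
    what the induction for Ville's inequality carries forward. *)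
Lemma markov_split (A : set Omega) (f : Omega -> \bar R) (c : R) :
  measurable A -> measurable_fun setT f -> (forall w, 0 <= f w) -> (0 <= c)%R ->
  c%:E * P (A `&` [set w | c%:E <= f w]) +
    \int[P]_(w in A `&` [set w | f w < c%:E]) f w <= \int[P]_(w in A) f w.
Proof.
move=> mA mf f0 c0.
have mge : measurable (A `&` [set w | c%:E <= f w]).
  by apply: emeasurable_fun_c_infty => //; exact: measurable_funTS.
have mlt : measurable (A `&` [set w | f w < c%:E]).
  by apply: emeasurable_fun_infty_o => //; exact: measurable_funTS.
have {3}-> : A = (A `&` [set w | c%:E <= f w]) `|` (A `&` [set w | f w < c%:E]).
  rewrite -setIUr; apply/esym/setIidPl => w _ /=.
  by case: leP; [left|right].
rewrite ge0_integral_setU//; first last.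
- apply/disj_setPS => w [[_ /= +] [_ /=]].
  by move=> /le_lt_trans/[apply]; rewrite ltxx.
- exact: measurable_funTS.
apply: leeD2r; rewrite -integral_cst//.
apply: ge0_le_integral => //; last by move=> w [].
exact: measurable_funTS.
Qed.

(* Ville's inequality, from the supermartingale property restricted to the
   events on which the level has not been reached yet. *)
Lemma ville_inequality (M : nat -> Omega -> \bar R) (delta : R) :
  (0 < delta)%R -> (forall t, measurable_fun setT (M t)) ->
  (forall t w, 0 <= M t w) -> \int[P]_w M 0%N w <= 1 ->
  (forall t, let B := [set w | forall s, (s <= t)%N -> M s w < (delta^-1)%:E] in
     \int[P]_(w in B) M t.+1 w <= \int[P]_(w in B) M t w) ->
  P [set w | exists t, (delta^-1)%:E <= M t w] <= delta%:E.
Proof.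
move=> delta0 mM M0 M01 superM; set c := (delta^-1)%R.
have c0 : (0 <= c)%R by rewrite invr_ge0 ltW.
pose B t := [set w | forall s, (s <= t)%N -> M s w < c%:E].
have BS t : B t.+1 = B t `&` [set w | M t.+1 w < c%:E].
  apply/seteqP; split => w /=.
    by move=> H; split => [s st|]; apply: H => //; exact: leqW.
  by move=> [H1 H2] s; rewrite leq_eqVlt => /predU1P[->//|]; exact: H1.
have B0 : B 0%N = setT `&` [set w | M 0%N w < c%:E].
  apply/seteqP; split => w /=.
    by move=> H; split => //; exact: H.
  by move=> [_ H] s; rewrite leqn0 => /eqP ->.
have mB t : measurable (B t).
  elim: t => [|t IH]; rewrite ?B0 ?BS; apply: emeasurable_fun_infty_o => //.
  exact: measurable_funTS.
(* Invariant of the process stopped when it reaches [c]: paths that have crossed count for [c] each,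
   the others for their current value, and the total stays at most 1. *)
have key t : c%:E * P (~` B t) + \int[P]_(w in B t) M t w <= 1.
  elim: t => [|t IH].
    apply: le_trans M01; rewrite B0.
    have -> : ~` (setT `&` [set w | M 0%N w < c%:E]) =
        setT `&` [set w | c%:E <= M 0%N w].
      by rewrite !setTI; apply/seteqP; split => w /=; rewrite leNgt => /negP.
    exact: markov_split.
  (* A crossing by time [t.+1] either occurred by time [t] or occurs for the first time at [t.+1];
     the integral over [B t] pays for the latter. *)
  have -> : ~` B t.+1 = ~` B t `|` (B t `&` [set w | c%:E <= M t.+1 w]).
    rewrite BS setCI; apply/seteqP; split => w /=.
      move=> [|H]; first by left.
      have [Bw|] := pselect (B t w); last by left.
      by right; split => //; rewrite leNgt; exact/negP.
    move=> [|[_]]; first by left.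
    by rewrite leNgt => /negP; right.
  rewrite BS; apply: le_trans IH.
  have mge : measurable (B t `&` [set w | c%:E <= M t.+1 w]).
    by apply: emeasurable_fun_c_infty => //; exact: measurable_funTS.
  apply: (@le_trans _ _ (c%:E * P (~` B t) +
      (c%:E * P (B t `&` [set w | c%:E <= M t.+1 w]) +
       \int[P]_(w in B t `&` [set w | M t.+1 w < c%:E]) M t.+1 w))).
    rewrite [leRHS]addeA; apply: leeD; last by [].
    rewrite -ge0_muleDr//.
    apply: lee_wpmul2l => //.
    by apply: measureU2 => //; exact: measurableC.
  apply: leeD2l; apply: le_trans (superM t).
  exact: markov_split.
have key' t : P (~` B t) <= delta%:E.
  rewrite -[delta]mulr1 EFinM -lee_pdivrMl//; apply: le_trans (key t).
  by rewrite leeDl// integral_ge0.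
have -> : [set w | exists t, c%:E <= M t w] = \bigcup_t ~` B t.
  apply/seteqP; split => w /=.
    move=> [t ctw]; exists t => //= /(_ t (leqnn t)).
    by rewrite ltNge ctw.
  move=> [t _ /= nB]; apply/not_existsP => H; apply: nB => s _.
  by rewrite ltNge; exact/negP.
(* The crossing events increase with [t], so the uniform bound passes to their union by continuity
   from below. *)
have cvgP : (P \o (fun t => ~` B t)) x @[x --> \oo] --> P (\bigcup_t ~` B t).
  apply: nondecreasing_cvg_mu.
  - by move=> t; exact: measurableC.
  - by apply: bigcupT_measurable => t; exact: measurableC.
  - move=> t u tu; apply/subsetPset => w /= nB H; apply: nB => s st.
    exact/H/(leq_trans st).
rewrite -(cvg_lim _ cvgP)//; apply: lime_le; first by apply/cvg_ex; eexists; exact: cvgP.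
by apply: nearW => t; exact: key'.
Qed.

End ville.

(** * Monotonicity and measurability of the boundary *)

Section u_bound_theory.
Context {R : realType} (q : probability R R).

Lemma measurable_psiE : measurable_fun setT (@psiE R).
Proof.
apply: measurable_funB => //; apply: measurableT_comp => //.
apply: measurableT_comp => //; exact: measurable_funB.
Qed.

(** As [psiE] is nonnegative on [0,1), a larger variance term lowers the integrand and hence admits
    more values of [S] in the supremum. *)
Lemma le_u_bound (deltaT V W : R) : V <= W ->
  (u_bound q deltaT V <= u_bound q deltaT W)%E.
Proof.
move=> VW; apply: le_ereal_sup => _ [S /= SV <-]; exists S => //=.
apply: le_lt_trans SV.
have mE (U : R) : measurable_fun setT (fun l : R => (expR (l * S - psiE l * U))%:E).
  apply/measurable_EFinP; apply: measurableT_comp => //.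
  apply: measurable_funB; apply: measurable_funM => //; exact: measurable_psiE.
apply: ge0_le_integral => //.
- exact: (measurable_funTS (mE _)).
- exact: (measurable_funTS (mE _)).
- move=> l /=; rewrite in_itv/= => l01; rewrite lee_fin ler_expR lerD2l lerN2.
  by rewrite ler_wpM2l// psiE_ge0.
Qed.

(** By monotonicity the strict sublevel sets are closed downwards, hence intervals. *)
Lemma measurable_u_bound (deltaT : R) : measurable_fun setT (u_bound q deltaT).
Proof.
move=> mD; apply: (measurability _ (ErealGenInftyO.measurableE R)) => //.
move=> _ /= -[_ [r ->] <-]; rewrite setTI; apply: is_interval_measurable.
move=> s t /= + + x /andP[_ xt]; rewrite !in_itv/= => _ tr.
exact: le_lt_trans (le_u_bound _ _ _ xt) tr.
Qed.

End u_bound_theory.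

(** * Risk monitoring *)

Section tonelli_restriction.
Context {R : realType} {d1 d2 : measure_display} {T1 : measurableType d1}
  {T2 : measurableType d2} (m1 : probability T1 R) (m2 : probability T2 R)
  (A : set T1) (D : set T2) (f : T1 * T2 -> \bar R).
Hypotheses (mA : measurable A) (mD : measurable D)
  (mf : measurable_fun setT f) (f0 : forall z, (0 <= f z)%E).
Local Open Scope ereal_scope.

Let f' := f \_ (A `*` D).

Let mf' : measurable_fun setT f'.
Proof.
apply: (iffLR (measurable_restrictT f (measurableX mA mD))).
exact: measurable_funTS.
Qed.

Let f'0 z : 0 <= f' z.
Proof. by rewrite /f' patchE; case: ifP. Qed.

Let f'E x y : f' (x, y) = if x \in A then (f (x, y)) * (\1_D y)%:E else 0.
Proof.
rewrite /f' patchE in_setX indicE/=; case: (x \in A) => //=.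
by case: (y \in D); rewrite ?mule1 ?mule0.
Qed.

(** Extension by zero outside [A]*[D] reduces the exchange to Tonelli's theorem on the whole
    product. *)
Lemma tonelli_restrict :
  \int[m1]_(x in A) \int[m2]_(y in D) f (x, y) =
  \int[m2]_(y in D) \int[m1]_(x in A) f (x, y).
Proof.
transitivity (\int[m1]_x \int[m2]_y f' (x, y)).
  rewrite integral_mkcond; apply: eq_integral => x _; rewrite patchE.
  case: ifPn => xA.
    rewrite integral_mkcond; apply: eq_integral => y _.
    by rewrite patchE f'E xA indicE; case: (y \in D); rewrite ?mule1 ?mule0.
  by rewrite integral0_eq// => y _; rewrite f'E (negbTE xA).
rewrite fubini_tonelli// [RHS]integral_mkcond; apply: eq_integral => y _.
rewrite patchE; case: ifPn => yD.
  rewrite [RHS]integral_mkcond; apply: eq_integral => x _.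
  by rewrite patchE f'E; case: ifP => // _; rewrite indicE yD mule1.
by rewrite integral0_eq// => x _; rewrite f'E indicE (negbTE yD) mule0; case: ifP.
Qed.

End tonelli_restriction.

Lemma average01 {R : realType} (m : nat) (a : 'I_m -> R) : (0 < m)%N ->
  (forall i, 0 <= a i <= 1) -> 0 <= m%:R^-1 * \sum_(i < m) a i <= 1.
Proof.
move=> m0 a01; have mR : 0 < m%:R :> R by rewrite ltr0n.
rewrite mulr_ge0 ?invr_ge0 ?(ltW mR)//=; last first.
  by apply: sumr_ge0 => i _; have /andP[] := a01 i.
rewrite mulrC ler_pdivrMr// mul1r -[m in leRHS]card_ord -sumr_const.
by apply: ler_sum => i _; have /andP[] := a01 i.
Qed.

Lemma run_avg01 {R : realType} (a : nat -> R) (t : nat) : (0 < t)%N ->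
  (forall s, (0 < s)%N -> 0 <= a s <= 1) -> 0 <= run_avg a t <= 1.
Proof.
move=> t0 a01; rewrite /run_avg big_add1 /= big_mkord.
by apply: average01 => // i; exact: a01.
Qed.

(** All three averages lie in [0,1], and the two weighted by [eta] enter with opposite signs, so
    each moves the estimate by at most [etamax], one up and one down. This is what places the
    rescaled estimate in [0,1]. *)
Lemma Rhat_PP_bounds {R : realType} {X O : Type} {C : nat} (f : X -> O)
    (ell : O -> 'I_C.+1 -> R) (fp : X -> 'I_C.+1 -> R) (n N : nat)
    (eta etamax : R) (lab : nat -> (X * 'I_C.+1)%type) (unl : nat -> X) :
  (forall o c, 0 <= ell o c <= 1) -> (0 < n)%N -> (0 < N)%N ->
  0 <= eta <= etamax ->
  - etamax <= Rhat_PP f ell fp n N eta lab unl <= 1 + etamax.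
Proof.
move=> ell01 n0 N0 /andP[e0 e1]; rewrite /Rhat_PP -!mulrA.
set a := N%:R^-1 * _; set b := n%:R^-1 * _; set c := n%:R^-1 * _.
have /andP[a0 a1] : 0 <= a <= 1 by apply: average01 => // i.
have /andP[b0 b1] : 0 <= b <= 1 by apply: average01 => // i.
have /andP[c0 c1] : 0 <= c <= 1 by apply: average01 => // i.
have ea0 : 0 <= eta * a by rewrite mulr_ge0.
have ec0 : 0 <= eta * c by rewrite mulr_ge0.
have ea1 : eta * a <= eta by rewrite ler_piMr.
have ec1 : eta * c <= eta by rewrite ler_piMr.
by apply/andP; split; lra.
Qed.

(** * The betting process of the monitor and its filtration *)

Section pprm.
Context {R : realType} {d dX : measure_display} {Omega : measurableType d}
  {X : measurableType dX} {O : Type} {C : nat} (P : probability Omega R)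
  (f : X -> O) (ell : O -> 'I_C.+1 -> R) (fp : X -> 'I_C.+1 -> R).
Hypotheses (ell01 : forall o c, 0 <= ell o c <= 1)
  (mell : measurable_fun setT (fun z : (X * 'I_C.+1)%type => ell (f z.1) z.2))
  (mell_synth : measurable_fun setT (fun x : X => ell (f x) (synth_label fp x))).
Context (Pt : nat -> probability (X * 'I_C.+1)%type R) (n N : nat -> nat)
  (n0 N0 : nat).
Hypotheses (n_pos : forall t, (0 < t)%N -> (0 < n t)%N)
  (N_pos : forall t, (0 < t)%N -> (0 < N t)%N).
Context (zl : nat -> nat -> Omega -> (X * 'I_C.+1)%type)
  (xu : nat -> nat -> Omega -> X)
  (zs : nat -> Omega -> (X * 'I_C.+1)%type) (xs : nat -> Omega -> X).
Hypotheses
  (mzl : forall t i, (0 < t)%N -> (i < n t)%N -> measurable_fun setT (zl t i))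
  (mxu : forall t j, (0 < t)%N -> (j < N t)%N -> measurable_fun setT (xu t j))
  (mzs : forall i, (i < n0)%N -> measurable_fun setT (zs i))
  (mxs : forall j, (j < N0)%N -> measurable_fun setT (xs j))
  (zl_law : forall t i, (0 < t)%N -> (i < n t)%N -> forall B, measurable B ->
     P (zl t i @^-1` B) = Pt t B)
  (xu_law : forall t j, (0 < t)%N -> (j < N t)%N -> forall B, measurable B ->
     P (xu t j @^-1` B) = Pt t (B `*` setT))
  (indep : mutually_independent P (data_valid n N n0 N0)
     (data_sigma zl xu zs xs)).
Context (etamax : R) (eta : nat -> Omega -> R).
Hypotheses (etamax_pos : 0 < etamax)
  (eta_range : forall t w, (0 < t)%N -> 0 <= eta t w <= etamax)
  (eta_pred : forall t, (0 < t)%N -> forall B : set R, measurable B ->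
     <<s \bigcup_(i in observed_before n N t) data_sigma zl xu zs xs i >>
       (eta t @^-1` B)).
Context (z0 : R).
Hypothesis z0_01 : 0 <= z0 <= 1.

Let ds := data_sigma zl xu zs xs.
(** [observed_before] is strict in time, so the shift to [t.+1] makes this the data of times 1 to
    [t] inclusive. *)
Let history (t : nat) : set (set Omega) :=
  \bigcup_(i in observed_before n N t.+1) ds i.
Let OG (t : nat) : measurableType (history t).-sigma :=
  g_sigma_algebraType (history t).

Let Rh (w : Omega) (s : nat) : R :=
  Rhat_PP f ell fp (n s) (N s) (eta s w) (fun i => zl s i w) (fun j => xu s j w).
Let Z (w : Omega) : nat -> R := Zseq etamax (Rh w).
Let mu (s : nat) : R := (risk (Pt s) f ell + etamax) / (1 + 2 * etamax).
Let S (t : nat) (w : Omega) : R := \sum_(1 <= s < t.+1) (Z w s - mu s).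
Let V (t : nat) (w : Omega) : R := Vseq z0 (Z w) t.
Let M (l : R) (t : nat) (w : Omega) : R := expR (l * S t w - psiE l * V t w).

Lemma data_sigma_measurable (i : sample_idx) :
  data_valid n N n0 N0 i -> data_sigma zl xu zs xs i `<=` measurable.
Proof.
move: i => [t i|t i|i|i] /= => [[t0 it]|[t0 it]|it|it] _ [B mB <-];
  rewrite -[_ @^-1` _]setTI.
- exact: mzl.
- exact: mxu.
- exact: mzs.
- exact: mxs.
Qed.

Lemma observed_before_valid (t : nat) :
  observed_before n N t `<=` data_valid n N n0 N0.
Proof. by move=> [s i|s i|i|i] //= [s0 [_ si]]. Qed.

Let history_measurable t : history t `<=` measurable.
Proof.
by move=> A [i /observed_before_valid vi]; exact: data_sigma_measurable.
Qed.

Let history_mono s t : (s <= t)%N -> history s `<=` history t.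
Proof.
move=> st; apply: bigcup_subset => -[u i|u i|i|i] //= [u0 [us ui]];
  by split => //; split => //; rewrite (leq_trans us).
Qed.

Lemma preimg_sets_setI {d1 d2 : measure_display} {T1 : measurableType d1}
    {T2 : measurableType d2} (Y : T1 -> T2) :
  preimg_sets Y setT /\ setI_closed (preimg_sets Y).
Proof.
split; first by exists setT.
move=> _ _ [A mA <-] [B mB <-]; exists (A `&` B) => //; exact: measurableI.
Qed.

Lemma indep_history (t : nat) (j : sample_idx) (A B : set Omega) :
  data_valid n N n0 N0 j -> ~ observed_before n N t j ->
  <<s \bigcup_(i in observed_before n N t) data_sigma zl xu zs xs i >> A ->
  data_sigma zl xu zs xs j B -> P (A `&` B) = (P A * P B)%E.
Proof.
move=> vj nj; apply: (mutually_independent_sigma _ _ _ _ _ _ _ _ indep) => //.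
- exact: data_sigma_measurable.
- move=> i _; case: i => *; exact: preimg_sets_setI.
- exact: observed_before_valid.
Qed.

Let measurable_zl s t i : (0 < s)%N -> (s <= t)%N -> (i < n s)%N ->
  measurable_fun setT (zl s i : OG t -> _).
Proof.
move=> s0 st ni _ B mB; rewrite setTI; apply: sub_sigma_algebra.
by exists (LabI s i) => //; exists B.
Qed.

Let measurable_xu s t i : (0 < s)%N -> (s <= t)%N -> (i < N s)%N ->
  measurable_fun setT (xu s i : OG t -> _).
Proof.
move=> s0 st ni _ B mB; rewrite setTI; apply: sub_sigma_algebra.
by exists (UnlI s i) => //; exists B.
Qed.

(** The range of [s] extends one step beyond that for the samples: this is predictability of the
    weights. *)
Let measurable_eta s t : (0 < s)%N -> (s <= t.+1)%N ->
  measurable_fun setT (eta s : OG t -> R).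
Proof.
case: s => // s _ st _ B mB; rewrite setTI.
have := eta_pred s.+1 isT B mB; apply: sub_sigma_algebra2.
exact: history_mono.
Qed.

Let measurable_Rh s t : (0 < s)%N -> (s <= t)%N ->
  measurable_fun setT ((fun w => Rh w s) : OG t -> R).
Proof.
move=> s0 st; rewrite /Rh /Rhat_PP.
have me := measurable_eta s t s0 (leqW st).
apply: measurable_funB; first apply: measurable_funD.
- apply: measurable_funM; first exact: measurable_funM.
  apply: measurable_sum => j; apply: measurableT_comp mell_synth _.
  exact: measurable_xu.
- apply: measurable_funM => //; apply: measurable_sum => i.
  by apply: measurableT_comp mell _; exact: measurable_zl.
- apply: measurable_funM; first exact: measurable_funM.
  apply: measurable_sum => i.
  apply: (measurableT_comp mell_synth); apply: (measurableT_comp measurable_fst).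
  exact: measurable_zl.
Qed.

Let scale_pos : 0 < 1 + 2 * etamax.
Proof. by rewrite addr_gt0// mulr_gt0. Qed.

Let Z01 w s : (0 < s)%N -> 0 <= Z w s <= 1.
Proof.
move=> s0; rewrite /Z /Zseq.
have /andP[r0 r1] := Rhat_PP_bounds f ell fp (n s) (N s) (eta s w) etamax
  (fun i => zl s i w) (fun j => xu s j w) ell01 (n_pos _ s0) (N_pos _ s0)
  (eta_range s w s0).
rewrite divr_ge0 ?(ltW scale_pos)//=; last by rewrite /Rh; lra.
by rewrite ler_pdivrMr// /Rh; lra.
Qed.

Let Zbar01 w t : 0 <= Zbar z0 (Z w) t <= 1.
Proof. by case: t => [|t] //=; apply: run_avg01 => // s; exact: Z01. Qed.

Let measurable_Z s t : (0 < s)%N -> (s <= t)%N ->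
  measurable_fun setT ((fun w => Z w s) : OG t -> R).
Proof.
move=> s0 st; rewrite /Z /Zseq; apply: measurable_funM => //.
by apply: measurable_funD => //; exact: measurable_Rh.
Qed.

Let bounded_Z s t : (0 < s)%N -> (s <= t)%N ->
  bounded_mfun ((fun w => Z w s) : OG t -> R).
Proof.
move=> s0 st; apply: bounded_mfun01; first exact: measurable_Z.
by move=> w; exact: Z01.
Qed.

Let bounded_Zbar s t : (s <= t)%N ->
  bounded_mfun ((fun w => Zbar z0 (Z w) s) : OG t -> R).
Proof.
move=> st; apply: bounded_mfun01; last by move=> w; exact: Zbar01.
case: s st => // s st; apply: measurable_funM => //.
under eq_fun do rewrite big_add1 big_mkord.
apply: measurable_sum => i; apply: measurable_Z => //.
exact: leq_trans (ltn_ord i) st.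
Qed.

Let bounded_S s t : (s <= t)%N -> bounded_mfun (S s : OG t -> R).
Proof.
move=> st; rewrite /S.
rewrite (_ : (fun w => _) = fun w => \sum_(i < s) (Z w i.+1 - mu i.+1)); last first.
  by apply/funext => w; rewrite big_add1 big_mkord.
apply: bounded_mfun_sum => i; apply: bounded_mfunB; last exact: bounded_mfun_cst.
by apply: bounded_Z => //; exact: leq_trans (ltn_ord i) st.
Qed.

Let bounded_V s t : (s <= t)%N -> bounded_mfun (V s : OG t -> R).
Proof.
move=> st; rewrite /V /Vseq.
rewrite (_ : (fun w => _) =
    fun w => \sum_(i < s) (Z w i.+1 - Zbar z0 (Z w) i) ^+ 2); last first.
  by apply/funext => w; rewrite big_add1 big_mkord.
apply: bounded_mfun_sum => i.
have b : bounded_mfun ((fun w => Z w i.+1 - Zbar z0 (Z w) i) : OG t -> R).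
  apply: bounded_mfunB.
    by apply: bounded_Z => //; exact: leq_trans (ltn_ord i) st.
  by apply: bounded_Zbar; exact: ltnW (leq_trans (ltn_ord i) st).
exact: bounded_mfunM.
Qed.

Let bounded_M l s t : (s <= t)%N -> bounded_mfun (M l s : OG t -> R).
Proof.
move=> st; apply: bounded_mfun_expR; apply: bounded_mfunB.
  by apply: bounded_mfunM; [exact: bounded_mfun_cst|exact: bounded_S].
by apply: bounded_mfunM; [exact: bounded_mfun_cst|exact: bounded_V].
Qed.

(** The new factor has the shape treated in [supermartingale_step]; its centre is the running mean
    at time [t], which belongs to the past. *)
Let M_recr l t w : M l t.+1 w = M l t w *
  expR (l * (Z w t.+1 - mu t.+1) - psiE l * (Z w t.+1 - Zbar z0 (Z w) t) ^+ 2).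
Proof.
rewrite /M -expRD /S /V /Vseq big_nat_recr//= [in RHS]/=.
by rewrite [in LHS](@big_nat_recr _ _ _ t.+1 1)//=; congr expR; ring.
Qed.

(** Testing against all bounded nonnegative past-measurable [H] stands in for a conditional
    expectation. [Z] and [mu] are the same affine image of the estimate and of the risk, so the
    claim reduces to [Rhat_PP_centered]. *)
Let Z_centered t (H : Omega -> R) : bounded_mfun (H : OG t -> R) ->
  (forall w, 0 <= H w) ->
  \int[P]_w (H w * Z w t.+1) = mu t.+1 * \int[P]_w H w.
Proof.
move=> bH H0.
have E : \int[P]_w (H w * Rh w t.+1) =
    risk (Pt t.+1) f ell * \int[P]_w H w.
  apply: (Rhat_PP_centered P (history t) (history_measurable t) f ell fp ell01
    mell mell_synth (Pt t.+1) (n t.+1) (N t.+1) (zl t.+1) (xu t.+1)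
    (eta t.+1) H etamax) => //.
  - exact: n_pos.
  - exact: N_pos.
  - by move=> i; exact: mzl.
  - by move=> i; exact: mxu.
  - by move=> i; exact: zl_law.
  - by move=> i; exact: xu_law.
  - move=> i ni A B sA mB; apply: (indep_history t.+1 (LabI t.+1 i)) => //=.
      by case=> _ []; rewrite ltnn.
    by exists B.
  - move=> i ni A B sA mB; apply: (indep_history t.+1 (UnlI t.+1 i)) => //=.
      by case=> _ []; rewrite ltnn.
    by exists B.
  - exact: measurable_eta.
  - by move=> w; exact: eta_range.
have up u (k : Omega -> R) : bounded_mfun (k : OG u -> R) -> bounded_mfun k.
  case=> mk bk; split => //.
  exact: measurable_fun_g_sigma (history_measurable u) mk.
have bHP := up _ _ bH.
have bZP := up _ _ (bounded_Z t.+1 t.+1 isT (leqnn _)).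
have RhE w : Rh w t.+1 = (1 + 2 * etamax) * Z w t.+1 - etamax.
  by rewrite /Z /Zseq mulrC divfK ?gt_eqF// addrK.
have bRh : bounded_mfun (fun w => Rh w t.+1).
  rewrite (_ : (fun w => _) = fun w => (1 + 2 * etamax) * Z w t.+1 - etamax).
    apply: bounded_mfunB; last exact: bounded_mfun_cst.
    by apply: bounded_mfunM => //; exact: bounded_mfun_cst.
  by apply/funext => w; exact: RhE.
have bHR := bounded_mfunM _ _ bHP bRh.
have beH : bounded_mfun (fun w => etamax * H w).
  by apply: bounded_mfunM => //; exact: bounded_mfun_cst.
transitivity (\int[P]_w ((1 + 2 * etamax)^-1 * (H w * Rh w t.+1 + etamax * H w))).
  apply: eq_Rintegral => w _; rewrite /Z /Zseq; ring.
rewrite RintegralZl//; last exact/bounded_mfun_integrable/bounded_mfunD.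
rewrite RintegralD//; [|exact: bounded_mfun_integrable..].
rewrite RintegralZl//; last exact: bounded_mfun_integrable.
by rewrite E /mu; ring.
Qed.

(** The supermartingale property is expressed by integrals over past events; the indicator of [A]
    becomes part of the weight in [supermartingale_step]. *)
Let M_supermartingale l t (A : set Omega) : 0 <= l < 1 ->
  <<s history t >> A ->
  (\int[P]_(w in A) (M l t.+1 w)%:E <= \int[P]_(w in A) (M l t w)%:E)%E.
Proof.
move=> l01 sA.
have restrictE (g : Omega -> R) :
    (\int[P]_(w in A) (g w)%:E = \int[P]_w (\1_A w * g w)%:E)%E.
  rewrite integral_mkcond; apply: eq_integral => w _.
  by rewrite patchE indicE; case: (w \in A); rewrite ?mul1r ?mul0r.
rewrite !restrictE; under eq_integral do rewrite M_recr mulrA.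
apply: (@supermartingale_step _ _ _ P (history t) (Z ^~ t.+1)
  (fun w => Zbar z0 (Z w) t) (fun w => \1_A w * M l t w) (mu t.+1) l) => //.
- apply: measurable_fun_g_sigma (history_measurable t.+1) _.
  exact: measurable_Z.
- by move=> w; exact: Z01.
- exact: bounded_Zbar.
- apply: bounded_mfunM; last exact: bounded_M.
  exact: (@bounded_mfun_indic _ _ (OG t)).
- by move=> w; rewrite mulr_ge0 ?expR_ge0// indicE; case: (w \in A).
- by move=> H; exact: Z_centered.
Qed.

Context (q : probability R R) (deltaT : R).
Hypotheses (q01 : q `[0%R, 1%R[%classic = 1%E) (dT0 : 0 < deltaT < 1).

Let mixture (t : nat) (w : Omega) : \bar R :=
  (\int[q]_(l in `[0%R, 1%R[) (M l t w)%:E)%E.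

Let measurable_M s t : (s <= t)%N ->
  measurable_fun setT (fun z : OG t * R => (M z.2 s z.1)%:E).
Proof.
move=> st; apply/measurable_EFinP; apply: measurableT_comp => //.
have [mS _] := bounded_S s t st; have [mV _] := bounded_V s t st.
apply: measurable_funB; apply: measurable_funM => //.
- exact: measurableT_comp mS measurable_fst.
- exact: measurableT_comp measurable_psiE measurable_snd.
- exact: measurableT_comp mV measurable_fst.
Qed.

(** Measurability for the past, and not merely on [Omega], makes non-crossing up to time [t] a past
    event, as Ville's inequality for the mixture requires. *)
Let measurable_mixture s t : (s <= t)%N ->
  measurable_fun setT (mixture s : OG t -> \bar R).
Proof.
move=> st; pose h (z : OG t * R) := (M z.2 s z.1)%:E.
pose D : set (OG t * R) := setT `*` `[0%R, 1%R[.
have mD : measurable D by exact: measurableX.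
pose g := h \_ D.
have mg : measurable_fun setT g.
  apply: (iffLR (measurable_restrictT h mD)).
  by apply: measurable_funTS; exact: measurable_M.
have g0 z : (0 <= g z)%E.
  by rewrite /g patchE; case: ifP => // _; rewrite lee_fin expR_ge0.
have := @measurable_fun_fubini_tonelli_F _ _ _ _ _ q g mg g0.
congr (measurable_fun _ _); apply/funext => w.
rewrite /fubini_F /mixture [RHS]integral_mkcond; apply: eq_integral => l _.
by rewrite /g !patchE in_setX/= in_setT.
Qed.

Let ville_mixture :
  (P [set w | exists t, (deltaT^-1)%:E <= mixture t w] <= deltaT%:E)%E.
Proof.
have /andP[dT _] := dT0.
have mm t : measurable_fun setT (mixture t).
  apply: measurable_fun_g_sigma (history_measurable t) _.
  exact: measurable_mixture.
have mix0 t w : (0 <= mixture t w)%E.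
  by apply: integral_ge0 => l _; rewrite lee_fin expR_ge0.
have mix01 : (\int[P]_w mixture 0 w <= 1)%E.
  (* At time 0 both sums are empty, so the integrand is 1 and the mixture is the mass that [q] gives
     to [0,1). *)
  have E w : mixture 0 w = 1%E.
    rewrite /mixture (eq_integral (cst 1%E)).
      by rewrite integral_cst// mul1e; exact: q01.
    by move=> l _; rewrite /M /S /V /Vseq !big_geq// !mulr0 subrr expR0.
  rewrite (eq_integral (cst 1%E)) => [|w _]; last exact: E.
  by rewrite integral_cst// mul1e; exact: probability_le1.
apply: (ville_inequality P mixture deltaT dT mm mix0 mix01).
move=> t; set B := [set w | _].
have sB : <<s history t >> B.
  have -> : B = \bigcap_(s in [set s | (s <= t)%N])
      [set w | (mixture s w < (deltaT^-1)%:E)%E].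
    by apply/seteqP; split.
  have : (history t).-sigma.-measurable (\bigcap_(s in [set s | (s <= t)%N])
      [set w : OG t | (mixture s w < (deltaT^-1)%:E)%E]) => //.
  apply: bigcap_measurable => [|s st]; first by exists 0%N.
  rewrite -[X in measurable X]setTI; apply: emeasurable_fun_infty_o => //.
  exact: measurable_mixture.
have mB : measurable B by exact: measurable_g_sigma (history_measurable t) _ sB.
have mM s : measurable_fun setT (fun z : Omega * R => (M z.2 s z.1)%:E).
  have [mS _] := bounded_S s s (leqnn _); have [mV _] := bounded_V s s (leqnn _).
  have mS' := measurable_fun_g_sigma _ _ (history_measurable s) mS.
  have mV' := measurable_fun_g_sigma _ _ (history_measurable s) mV.
  apply/measurable_EFinP; apply: measurableT_comp => //.
  apply: measurable_funB; apply: measurable_funM => //.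
  - exact: measurableT_comp mS' measurable_fst.
  - exact: measurableT_comp measurable_psiE measurable_snd.
  - exact: measurableT_comp mV' measurable_fst.
have tonelli s : (\int[P]_(w in B) mixture s w =
    \int[q]_(l in `[0%R, 1%R[) \int[P]_(w in B) (M l s w)%:E)%E.
  apply: (tonelli_restrict P q B `[0%R, 1%R[%classic
    (fun z => (M z.2 s z.1)%:E)) => // z.
  by rewrite lee_fin expR_ge0.
(* After exchanging the integrals, the inequality holds for each fixed [l] and is integrated against
   [q]. *)
suff le_mix : (\int[q]_(l in `[0%R, 1%R[) \int[P]_(w in B) (M l t.+1 w)%:E <=
    \int[q]_(l in `[0%R, 1%R[) \int[P]_(w in B) (M l t w)%:E)%E.
  rewrite -(tonelli t.+1) in le_mix; rewrite -(tonelli t) in le_mix.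
  exact: le_mix.
have msec s : measurable_fun setT (fun l => \int[P]_(w in B) (M l s w)%:E)%E.
  pose h (z : Omega * R) := (M z.2 s z.1)%:E.
  pose g := h \_ (B `*` setT).
  have mg : measurable_fun setT g.
    apply: (iffLR (measurable_restrictT h (measurableX mB measurableT))).
    exact: (measurable_funTS (mM s)).
  have g0 z : (0 <= g z)%E.
    by rewrite /g patchE; case: ifP => // _; rewrite lee_fin expR_ge0.
  have := @measurable_fun_fubini_tonelli_G _ _ _ _ _ P g mg g0.
  congr (measurable_fun _ _); apply/funext => l.
  rewrite /fubini_G [RHS]integral_mkcond; apply: eq_integral => w _.
  by rewrite /g !patchE in_setX/= in_setT andbT.
apply: ge0_le_integral => //.
- by move=> l _; apply: integral_ge0 => w _; rewrite lee_fin expR_ge0.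
- exact: measurable_funTS.
- exact: measurable_funTS.
- move=> l /=; rewrite in_itv/= => l01; exact: M_supermartingale.
Qed.

Let measurable_run_avg (F : nat -> Omega -> R) t :
  (forall s, (0 < s)%N -> measurable_fun setT (F s)) ->
  measurable_fun setT (fun w => run_avg (F ^~ w) t).
Proof.
move=> mF; apply: measurable_funM => //.
under eq_fun do rewrite big_add1 big_mkord.
by apply: measurable_sum => i; exact: mF.
Qed.

Lemma measurable_L_PP t :
  measurable_fun setT (fun w => L_PP etamax z0 q deltaT
    (fun s => Rhat_PP f ell fp (n s) (N s) (eta s w)
                (fun i => zl s i w) (fun j => xu s j w)) t).
Proof.
apply: emeasurable_funB.
  apply/measurable_EFinP.
  apply: (measurable_run_avg (fun s w => Rh w s)) => s s0.
  apply: measurable_fun_g_sigma (history_measurable s) _.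
  exact: measurable_Rh.
apply: measurable_funeM.
apply: measurableT_comp (measurable_u_bound q deltaT) _.
have [mV _] := bounded_V t t (leqnn _).
exact: measurable_fun_g_sigma (history_measurable t) mV.
Qed.

(** By contraposition: if the mixture is below the level, then [S t w] belongs to the set whose
    supremum defines the boundary, so the boundary dominates [S t w]. *)
Let mixture_ge t w : (0 < t)%N ->
  ((run_avg (fun s => risk (Pt s) f ell) t)%:E <
    L_PP etamax z0 q deltaT (Rh w) t)%E ->
  ((deltaT^-1)%:E <= mixture t w)%E.
Proof.
move=> t0; rewrite leNgt; apply: contraTN => mix_lt; rewrite -leNgt /L_PP.
set c := (1 + 2 * etamax) / t%:R.
have c0 : 0 <= c by rewrite divr_ge0 ?(ltW scale_pos).
have Su : ((S t w)%:E <= u_bound q deltaT (Vseq z0 (Zseq etamax (Rh w)) t))%E.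
  by apply: ereal_sup_ubound; exists (S t w).
(* The factor [c] undoes both the rescaling in [Z] and the missing division by [t] in [S], so
   [c * S t w] is the averaged estimation error. *)
have -> : run_avg (fun s => risk (Pt s) f ell) t = run_avg (Rh w) t - c * S t w.
  rewrite /run_avg /S /c.
  have -> : \sum_(1 <= s < t.+1) (Z w s - mu s) = (1 + 2 * etamax)^-1 *
      (\sum_(1 <= s < t.+1) Rh w s - \sum_(1 <= s < t.+1) risk (Pt s) f ell).
    rewrite -sumrB mulr_sumr; apply: eq_bigr => s _.
    by rewrite /Z /Zseq /mu; ring.
  have a0 : 1 + 2 * etamax != 0 by rewrite gt_eqF.
  have t0' : t%:R != 0 :> R by rewrite pnatr_eq0 -lt0n.
  field; by rewrite ?a0 ?t0'.
rewrite EFinB (EFinM c (S t w)); apply: leeB; first by [].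
by apply: lee_wpmul2l; rewrite ?lee_fin.
Qed.

(** Whenever the lower bound exceeds the running risk, the mixture has reached its level at that
    same time, so the event is contained in the one controlled by [ville_mixture]. *)
Lemma L_PP_coverage :
  (P [set w | exists t, (0 < t)%N /\
      ((run_avg (fun s => risk (Pt s) f ell) t)%:E <
       L_PP etamax z0 q deltaT
         (fun s => Rhat_PP f ell fp (n s) (N s) (eta s w)
                     (fun i => zl s i w) (fun j => xu s j w)) t)%E]
   <= deltaT%:E)%E.
Proof.
apply: le_trans ville_mixture; apply: le_measure; rewrite ?inE.
- rewrite (_ : [set w | _] = \bigcup_(t in [set t | (0 < t)%N]) (setT `&` [set w |
      ((run_avg (fun s => risk (Pt s) f ell) t)%:E <
        L_PP etamax z0 q deltaT (Rh w) t)%E])); last first.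
    by apply/seteqP; split=> w /= [t]; [case=> t0 H|move=> t0 [_ H]]; exists t.
  apply: bigcup_measurable => t _; apply: measurable_lte => //.
  exact: measurable_L_PP.
- rewrite (_ : [set w | _] = \bigcup_t (setT `&` [set w |
      ((deltaT^-1)%:E <= mixture t w)%E])); last first.
    by apply/seteqP; split=> w /= [t]; [move=> H|move=> _ [_ H]]; exists t.
  apply: bigcup_measurable => t _; apply: emeasurable_fun_c_infty => //.
  apply: measurable_fun_g_sigma (history_measurable t) _.
  exact: measurable_mixture.
- by move=> w /= [t [t0 H]]; exists t; exact: mixture_ge.
Qed.

End pprm.

(** * Union bound over source and test errors *)

Theorem theorem3p2
  (R : realType)
  (* feature space X subset of R^D, labels {1,...,C+1} encoded as 'I_C.+1 *)
  (D C : nat) (Xset : set (D.-tuple R)) (mXset : measurable Xset)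
  (* output space, deployed model, loss with values in [0,1], predictive model *)
  (O : Type) (f : D.-tuple R -> O) (ell : O -> 'I_C.+1 -> R)
  (ell01 : forall o c, 0 <= ell o c <= 1)
  (fp : D.-tuple R -> 'I_C.+1 -> R)
  (mell : measurable_fun setT
     (fun z : (D.-tuple R * 'I_C.+1)%type => ell (f z.1) z.2))
  (mell_synth : measurable_fun setT
     (fun x : D.-tuple R => ell (f x) (synth_label fp x)))
  (* source distribution P0 and test distributions P_t (t >= 1) on X x Y *)
  (P0 : probability (D.-tuple R * 'I_C.+1)%type R)
  (Pt : nat -> probability (D.-tuple R * 'I_C.+1)%type R)
  (P0X : P0 (Xset `*` setT) = 1%E)
  (PtX : forall t, (0 < t)%N -> Pt t (Xset `*` setT) = 1%E)
  (* underlying probability space *)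
  (d : measure_display) (Omega : measurableType d) (P : probability Omega R)
  (* batch sizes *)
  (n N : nat -> nat) (n_pos : forall t, (0 < t)%N -> (0 < n t)%N)
  (N_pos : forall t, (0 < t)%N -> (0 < N t)%N)
  (n0 N0 : nat)
  (* samples: labeled test zl t i, unlabeled test xu t j,
     labeled source zs i, unlabeled source xs j *)
  (zl : nat -> nat -> Omega -> (D.-tuple R * 'I_C.+1)%type)
  (xu : nat -> nat -> Omega -> D.-tuple R)
  (zs : nat -> Omega -> (D.-tuple R * 'I_C.+1)%type)
  (xs : nat -> Omega -> D.-tuple R)
  (mzl : forall t i, (0 < t)%N -> (i < n t)%N -> measurable_fun setT (zl t i))
  (mxu : forall t j, (0 < t)%N -> (j < N t)%N -> measurable_fun setT (xu t j))
  (mzs : forall i, (i < n0)%N -> measurable_fun setT (zs i))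
  (mxs : forall j, (j < N0)%N -> measurable_fun setT (xs j))
  (zl_law : forall t i, (0 < t)%N -> (i < n t)%N -> forall B, measurable B ->
     P (zl t i @^-1` B) = Pt t B)
  (xu_law : forall t j, (0 < t)%N -> (j < N t)%N -> forall B, measurable B ->
     P (xu t j @^-1` B) = Pt t (B `*` setT))
  (zs_law : forall i, (i < n0)%N -> forall B, measurable B ->
     P (zs i @^-1` B) = P0 B)
  (xs_law : forall j, (j < N0)%N -> forall B, measurable B ->
     P (xs j @^-1` B) = P0 (B `*` setT))
  (indep : mutually_independent P (data_valid n N n0 N0)
     (data_sigma zl xu zs xs))
  (* predictable weights eta_t in [0, etamax] *)
  (etamax : R) (etamax_pos : 0 < etamax)
  (eta : nat -> Omega -> R)
  (eta_range : forall t w, (0 < t)%N -> 0 <= eta t w <= etamax)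
  (eta_pred : forall t, (0 < t)%N -> forall B : set R, measurable B ->
     <<s \bigcup_(i in observed_before n N t) data_sigma zl xu zs xs i >>
       (eta t @^-1` B))
  (* \bar Z_0 *)
  (z0 : R) (z0_01 : 0 <= z0 <= 1)
  (* confidence levels and mixing distribution *)
  (deltaS deltaT : R) (dS01 : 0 < deltaS < 1) (dT01 : 0 < deltaT < 1)
  (dST : 0 < deltaS + deltaT < 1)
  (q : probability R R) (q01 : q `[0%R, 1%R[%classic = 1%E)
  (* source upper bound: a function of the source data only, valid w.p. 1 - deltaS *)
  (U0 : Omega -> R)
  (U0_src : forall B : set R, measurable B ->
     <<s \bigcup_(i in source_sample n0 N0) data_sigma zl xu zs xs i >>
       (U0 @^-1` B))
  (U0_valid : (P [set w | (risk P0 f ell <= U0 w)%R] >= (1 - deltaS)%:E)%E)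
  (* tolerance and null hypothesis H0 *)
  (eps_tol : R) (eps_pos : 0 < eps_tol)
  (H0 : forall t, (0 < t)%N ->
     run_avg (fun s => risk (Pt s) f ell) t <= risk P0 f ell + eps_tol) :
  (P [set w | exists t, (0 < t)%N /\
      ((U0 w + eps_tol)%:E <
       L_PP etamax z0 q deltaT
         (fun s => Rhat_PP f ell fp (n s) (N s) (eta s w)
                     (fun i => zl s i w) (fun j => xu s j w)) t)%E]
   <= (deltaS + deltaT)%:E)%E.

Proof.
set Rh := fun w s => Rhat_PP f ell fp (n s) (N s) (eta s w)
  (fun i => zl s i w) (fun j => xu s j w).
pose Lt w t := L_PP etamax z0 q deltaT (Rh w) t.
have dT0 : 0 < deltaT by case/andP: dT01.
have mds := data_sigma_measurable n N n0 N0 zl xu zs xs mzl mxu mzs mxs.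
have mU0 : measurable_fun setT U0.
  move=> _ B mB; rewrite setTI; apply: measurable_g_sigma (U0_src B mB).
  by move=> A [i si]; apply: (mds i); case: i si.
have mL t : measurable_fun setT (Lt ^~ t).
  exact: (measurable_L_PP f ell fp ell01 mell mell_synth n N n0 N0 n_pos N_pos
    zl xu zs xs mzl mxu mzs mxs etamax eta etamax_pos eta_range eta_pred z0
    z0_01 q deltaT).
(* The two sources of error: the source bound falls short of the source risk, or the test lower
   bound overshoots the running test risk. *)
pose Miss := [set w | U0 w < risk P0 f ell].
pose Over := [set w | exists t, (0 < t)%N /\
  ((run_avg (fun s => risk (Pt s) f ell) t)%:E < Lt w t)%E].
have mlt (g : nat -> Omega -> R) : (forall t, measurable_fun setT (g t)) ->
    measurable [set w | exists t, (0 < t)%N /\ ((g t w)%:E < Lt w t)%E].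
  move=> mg; rewrite (_ : [set w | _] = \bigcup_(t in [set t | (0 < t)%N])
      (setT `&` [set w | ((g t w)%:E < Lt w t)%E])); last first.
    by apply/seteqP; split=> w /= [t]; [case=> t0 H|move=> t0 [_ H]]; exists t.
  apply: bigcup_measurable => t _; apply: measurable_lte => //.
  exact/measurable_EFinP.
have mOver : measurable Over by exact: (mlt (fun t _ => run_avg _ t)).
have mHit : measurable [set w | risk P0 f ell <= U0 w].
  rewrite -[X in measurable X]setTI; exact: measurable_fun_le.
have MissE : Miss = ~` [set w | risk P0 f ell <= U0 w].
  by apply/seteqP; split => w; rewrite /Miss /= ltNge => /negP.
have mMiss : measurable Miss by rewrite MissE; exact: measurableC.
have PMiss : (P Miss <= deltaS%:E)%E.
  rewrite MissE probability_setC//; move: U0_valid.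
  rewrite -(fineK (fin_num_measure P _ mHit)) -EFinB !lee_fin; lra.
apply: (@le_trans _ _ (P (Miss `|` Over))).
  apply: le_measure; rewrite ?inE.
  - apply: (mlt (fun _ w => U0 w + eps_tol)) => _; exact: measurable_funD.
  - exact: measurableU.
  - move=> w /= [t [t0 H]].
    (* Outside [Miss], the null hypothesis bounds the running risk by [risk P0 f ell + eps_tol],
       hence by [U0 w + eps_tol], which an alarm places strictly below the lower bound. *)
    have [|R0U] := ltP (U0 w) (risk P0 f ell); first by left.
    right; exists t; split => //; apply: le_lt_trans H.
    by rewrite lee_fin (le_trans (H0 t t0))// lerD2r.
apply: le_trans (measureU2 P mMiss mOver) _; rewrite EFinD.
apply: leeD; first exact: PMiss.
exact: (L_PP_coverage P f ell fp ell01 mell mell_synth Pt n N n0 N0 n_pos N_pos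
  zl xu zs xs mzl mxu mzs mxs zl_law xu_law indep etamax eta etamax_pos eta_range
  eta_pred z0 z0_01 q deltaT q01 dT01).
Qed.
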